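(* Let $f,r:\mathbb{R}\to(0,\infty)$ be smooth even functions (a reflection-symmetric wormhole background with throat at $x=0$) such that, as $|x|\to\infty$, $r(x)=|x|/f_0+O(1)$ and $f(x)=f_0+O(1/|x|)$ for some constant $f_0>0$. Let $\mu>0$, $\ell\in\{1/2,3/2,5/2,\dots\}$, $0<\omega<\mu f_0$, and let $(\psi_0,\psi_1,\psi_2,\psi_3)$ be a real bound-state solution of the radial Dirac equation (given in the context) on this background. If the bilinears $$S=\psi_0^2+\psi_1^2+\psi_2^2+\psi_3^2,\quad D=\psi_0^2-\psi_1^2-\psi_2^2+\psi_3^2,\quad P=2(-1)^{\ell-1/2}(\psi_0\psi_1-\psi_2\psi_3)$$ are all even functions of $x$, then $(\psi_0,\psi_1,\psi_2,\psi_3)$ is an eigenstate of the reflection operator $Z^*$ with eigenvalue $+1$ or $-1$; equivalently, for one choice of sign, $$\psi_0(x)=\pm\psi_3(-x),\qquad \psi_1(x)=\mp\psi_2(-x)\qquad\text{for all }x\in\mathbb{R}.$$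
   Context: The spacetime metric is $ds^2=f(x)^2dt^2-f(x)^{-2}dx^2-r(x)^2(d\theta^2+\sin^2\theta\,d\varphi^2)$. With $\kappa=(-1)^{\ell-1/2}$, the radial Dirac equation for mass $\mu$, frequency $\omega$ and angular number $\ell$ is (prime is $d/dx$) $$f\psi_0'+\tfrac{\omega}{f}\psi_1-\tfrac{\ell+1/2}{r}\psi_1+\kappa\mu\psi_0=0,\qquad f\psi_1'-\tfrac{\omega}{f}\psi_0-\tfrac{\ell+1/2}{r}\psi_0-\kappa\mu\psi_1=0,$$ $$f\psi_2'-\tfrac{\omega}{f}\psi_3-\tfrac{\ell+1/2}{r}\psi_3+\kappa\mu\psi_2=0,\qquad f\psi_3'+\tfrac{\omega}{f}\psi_2-\tfrac{\ell+1/2}{r}\psi_2-\kappa\mu\psi_3=0.$$ A bound-state solution is a nontrivial solution decaying exponentially as $x\to+\infty$ and as $x\to-\infty$. The reflection operator $Z^*$, implementing $x\mapsto-x$ on spinors, acts on the radial components by $$(\psi_0,\psi_1,\psi_2,\psi_3)(x)\mapsto\kappa\,(\psi_3,-\psi_2,-\psi_1,\psi_0)(-x),$$ satisfies $(Z^* )^2=1$, and maps solutions to solutions on a background with $f,r$ even. *)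

(* Defs.v *)
From Stdlib Require Import Reals.
From Coquelicot Require Import Coquelicot.
Open Scope R_scope.

Definition smooth (g : R -> R) : Prop := forall (n : nat) (x : R), ex_derive_n g n x.

Definition even_fun (g : R -> R) : Prop := forall x : R, g (- x) = g x.

(* g = O(h) as |x| -> oo, i.e. at both ends of the real line. *)
Definition bigO_infty (g h : R -> R) : Prop :=
  exists C X : R, forall x : R, X < Rabs x -> Rabs (g x) <= C * Rabs (h x).

(* Metric functions of a static wormhole that is reflection symmetric about its
   throat x = 0 and asymptotically flat at both ends, f0 being the limit of f. *)
Record symmetric_wormhole (f r : R -> R) (f0 : R) : Prop := {
  sw_f_smooth : smooth f;
  sw_r_smooth : smooth r;
  sw_f_pos : forall x, 0 < f x;
  sw_r_pos : forall x, 0 < r x;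
  sw_f_even : even_fun f;
  sw_r_even : even_fun r;
  sw_f0_pos : 0 < f0;
  sw_r_asym : bigO_infty (fun x => r x - Rabs x / f0) (fun _ => 1);
  sw_f_asym : bigO_infty (fun x => f x - f0) (fun x => / Rabs x)
}.

(* The angular numbers 1/2, 3/2, 5/2, ... are indexed by n = ell - 1/2 : nat, so
   that kappa = (-1)^(ell - 1/2) is an ordinary natural power. *)
Definition ell (n : nat) : R := INR n + 1 / 2.
Definition kappa (n : nat) : R := (-1) ^ n.

Record spinor : Type := Spinor {
  psi0 : R -> R;
  psi1 : R -> R;
  psi2 : R -> R;
  psi3 : R -> R
}.

Definition nontrivial (psi : spinor) : Prop :=
  exists x, psi0 psi x <> 0 \/ psi1 psi x <> 0 \/ psi2 psi x <> 0 \/ psi3 psi x <> 0.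

(* Differentiability is required separately because [Derive] is total. *)
Record radial_dirac (f r : R -> R) (mu omega : R) (n : nat) (psi : spinor) : Prop := {
  rd_diff0 : forall x, ex_derive (psi0 psi) x;
  rd_diff1 : forall x, ex_derive (psi1 psi) x;
  rd_diff2 : forall x, ex_derive (psi2 psi) x;
  rd_diff3 : forall x, ex_derive (psi3 psi) x;
  rd_eq0 : forall x,
    f x * Derive (psi0 psi) x + omega / f x * psi1 psi x
      - (ell n + 1 / 2) / r x * psi1 psi x + kappa n * mu * psi0 psi x = 0;
  rd_eq1 : forall x,
    f x * Derive (psi1 psi) x - omega / f x * psi0 psi x
      - (ell n + 1 / 2) / r x * psi0 psi x - kappa n * mu * psi1 psi x = 0;
  rd_eq2 : forall x,
    f x * Derive (psi2 psi) x - omega / f x * psi3 psi x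
      - (ell n + 1 / 2) / r x * psi3 psi x + kappa n * mu * psi2 psi x = 0;
  rd_eq3 : forall x,
    f x * Derive (psi3 psi) x + omega / f x * psi2 psi x
      - (ell n + 1 / 2) / r x * psi2 psi x - kappa n * mu * psi3 psi x = 0
}.

Definition exp_decay (g : R -> R) : Prop :=
  (exists a C : R, 0 < a /\
     Rbar_locally p_infty (fun x => Rabs (g x) <= C * exp (- (a * x)))) /\
  (exists a C : R, 0 < a /\
     Rbar_locally m_infty (fun x => Rabs (g x) <= C * exp (a * x))).

Record bound_state (f r : R -> R) (mu omega : R) (n : nat) (psi : spinor) : Prop := {
  bs_dirac : radial_dirac f r mu omega n psi;
  bs_nontrivial : nontrivial psi;
  bs_decay0 : exp_decay (psi0 psi);
  bs_decay1 : exp_decay (psi1 psi);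
  bs_decay2 : exp_decay (psi2 psi);
  bs_decay3 : exp_decay (psi3 psi)
}.

Definition bilinear_S (psi : spinor) (x : R) : R :=
  psi0 psi x ^ 2 + psi1 psi x ^ 2 + psi2 psi x ^ 2 + psi3 psi x ^ 2.

Definition bilinear_D (psi : spinor) (x : R) : R :=
  psi0 psi x ^ 2 - psi1 psi x ^ 2 - psi2 psi x ^ 2 + psi3 psi x ^ 2.

Definition bilinear_P (n : nat) (psi : spinor) (x : R) : R :=
  2 * kappa n * (psi0 psi x * psi1 psi x - psi2 psi x * psi3 psi x).

(* The action Z^* on spinors of the reflection x |-> - x. *)
Definition Zstar (n : nat) (psi : spinor) : spinor :=
  Spinor (fun x => kappa n * psi3 psi (- x))
         (fun x => kappa n * - psi2 psi (- x))
         (fun x => kappa n * - psi1 psi (- x))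
         (fun x => kappa n * psi0 psi (- x)).

Definition eigenstate (T : spinor -> spinor) (lambda : R) (psi : spinor) : Prop :=
  nontrivial psi /\
  forall x, psi0 (T psi) x = lambda * psi0 psi x /\
            psi1 (T psi) x = lambda * psi1 psi x /\
            psi2 (T psi) x = lambda * psi2 psi x /\
            psi3 (T psi) x = lambda * psi3 psi x.

(* Main.v *)
(** With [L := (ell + 1/2) / r] and [W := omega / f], the pair [(psi0, psi1)] and the
    reflected pair [(psi3, - psi2)(- x)] solve the same planar system
    [u' = A v - g u], [v' = B u + g v] with even coefficients [A = (L - W) / f],
    [B = (L + W) / f], [g = kappa mu / f].  Evenness of S, D and P says exactly
    that the differences of the quadratic monomials [u^2], [v^2], [u v] of the two
    pairs are even.  The system writes the derivative of the difference of the
    [u^2] as an even function; it is also odd, hence zero, and the difference, which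
    vanishes at infinity, is zero.  The same holds for [v^2], and then for [u v]
    since [B > 0].  So the two pairs agree up to a sign at [x = 0], and everywhere
    by uniqueness for linear ODEs. *)

Require Import Defs.
From Stdlib Require Import Reals Lra.
From Coquelicot Require Import Coquelicot.
Open Scope R_scope.

(** * Calculus on the line: monotonicity, parity and a Gronwall estimate *)

Lemma deriv_nonpos_decreasing (F dF : R -> R) :
  (forall x, is_derive F x (dF x)) -> (forall x, dF x <= 0) ->
  forall x y, x <= y -> F y <= F x.
Proof.
  intros HF Hle x y Hxy.
  destruct (MVT_gen F x y dF) as [c [_ Hc]].
  - intros z _. apply HF.
  - intros z _. apply continuity_pt_filterlim.
    apply (ex_derive_continuous F z). exists (dF z). apply HF.
  - specialize (Hle c). nra.
Qed.

Lemma deriv_zero_constant (F : R -> R) :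
  (forall x, is_derive F x 0) -> forall x y, F x = F y.
Proof.
  assert (H : forall G : R -> R, (forall x, is_derive G x 0) ->
              forall x y, x <= y -> G y <= G x).
  { intros G HG. apply (deriv_nonpos_decreasing G (fun _ => 0)).
    - exact HG.
    - intros _. lra. }
  intros HF.
  assert (HN : forall x, is_derive (fun t => - F t) x 0).
  { intros x. replace 0 with (opp (0 : R)) by (unfold opp; simpl; ring).
    apply (is_derive_opp F x 0). apply HF. }
  assert (Hxy : forall x y, x <= y -> F x = F y).
  { intros x y L. pose proof (H F HF x y L). pose proof (H _ HN x y L).
    simpl in *. lra. }
  intros x y. destruct (Rle_dec x y) as [L | L].
  - apply Hxy. exact L.
  - symmetry. apply Hxy. lra.
Qed.

(** The chain rule applied to [F (- t)] makes the derivative of an even function odd; being even as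
    well, it vanishes. *)
Lemma even_deriv_zero (F dF : R -> R) :
  (forall x, is_derive F x (dF x)) -> even_fun F -> even_fun dF ->
  forall x, dF x = 0.
Proof.
  intros HF EF EdF x.
  assert (H : is_derive F x (- dF (- x))).
  { apply (is_derive_ext (fun t => F (- t)) F x).
    - exact EF.
    - replace (- dF (- x)) with (scal (-1) (dF (- x)))
        by (unfold scal; simpl; unfold mult; simpl; ring).
      apply (is_derive_comp F Ropp x (dF (- x)) (-1)).
      + apply HF.
      + auto_derive; [exact I | ring]. }
  pose proof (is_derive_unique _ _ _ H) as H1.
  rewrite (is_derive_unique _ _ _ (HF x)), EdF in H1. lra.
Qed.

Lemma constant_lim_zero (F : R -> R) :
  (forall x y, F x = F y) -> is_lim F p_infty 0 -> forall x, F x = 0.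
Proof.
  intros Hc Hl x.
  assert (H : is_lim F p_infty (F x)).
  { apply (is_lim_ext (fun _ => F x)).
    - intros y. apply Hc.
    - apply is_lim_const. }
  apply is_lim_unique in H. apply is_lim_unique in Hl.
  rewrite Hl in H. injection H. auto.
Qed.

(** Integrating factor: with [J] the integral of [M] from 0, [N * exp (- J)] is nonincreasing and
    [N * exp J] is nondecreasing. Both vanish at 0, which forces [N <= 0] to the right and to the
    left of 0 respectively. *)
Lemma gronwall_zero (N dN M : R -> R) :
  (forall x, continuous M x) -> (forall x, 0 <= N x) ->
  (forall x, is_derive N x (dN x)) -> (forall x, Rabs (dN x) <= M x * N x) ->
  N 0 = 0 -> forall x, N x = 0.
Proof.
  intros HM Npos HN Hb N0 x.
  set (J := fun y => RInt M 0 y).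
  assert (HJ : forall y, is_derive J y (M y)).
  { intros y. apply (is_derive_RInt M J 0 y).
    - exists (mkposreal 1 Rlt_0_1). intros z _. apply (RInt_correct M 0 z).
      apply (ex_RInt_continuous M). intros t _. apply HM.
    - apply HM. }
  (* The parameter [s] treats both sides of 0 at once: [s = 1] serves [x >= 0] and [s = -1] serves
     [x <= 0]. *)
  assert (HE : forall s y,
    is_derive (fun t => s * N t * exp (- (s * J t))) y
              ((s * dN y - s * s * M y * N y) * exp (- (s * J y)))).
  { intros s y. pose proof (HN y) as A. pose proof (HJ y) as B.
    auto_derive.
    - repeat split; eexists; eassumption.
    - rewrite (is_derive_unique (fun t : R => N t) _ _ A), (is_derive_unique (fun t : R => J t) _ _ B). ring. }
  assert (Hdec : forall s, s = 1 \/ s = -1 -> forall a b, a <= b ->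
    s * N b * exp (- (s * J b)) <= s * N a * exp (- (s * J a))).
  { intros s Hs. apply (deriv_nonpos_decreasing _ _ (HE s)).
    intros y. pose proof (exp_pos (- (s * J y))) as P.
    specialize (Hb y). apply Rabs_le_between in Hb.
    assert (s * dN y - s * s * M y * N y <= 0) by (destruct Hs; subst s; lra).
    nra. }
  assert (Hz : forall s, s = 1 \/ s = -1 -> 0 <= s * x -> N x <= 0).
  { intros s Hs Hx.
    assert (N x * exp (- (s * J x)) <= 0).
    { destruct Hs; subst s.
      - pose proof (Hdec 1 (or_introl eq_refl) 0 x ltac:(lra)) as H.
        rewrite N0 in H. lra.
      - pose proof (Hdec (-1) (or_intror eq_refl) x 0 ltac:(lra)) as H.
        rewrite N0 in H. lra. }
    pose proof (exp_pos (- (s * J x))). nra. }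
  apply Rle_antisym; [| apply Npos].
  destruct (Rle_dec 0 x).
  - apply (Hz 1); [left; reflexivity | lra].
  - apply (Hz (-1)); [right; reflexivity | lra].
Qed.

(** * The planar linear system and its quadratic monomials *)

Definition planar_solution (A B g u v : R -> R) : Prop := forall x,
  is_derive u x (A x * v x - g x * u x) /\ is_derive v x (B x * u x + g x * v x).

(** These derivatives are linear in the monomials [u ^ 2], [v ^ 2], [u * v], so the same formulas
    hold for differences of monomials of two solutions. *)
Lemma planar_solution_bilinear (A B g u v : R -> R) :
  planar_solution A B g u v -> forall x,
  is_derive (fun t => u t ^ 2) x (2 * (A x * (u x * v x) - g x * u x ^ 2)) /\
  is_derive (fun t => v t ^ 2) x (2 * (B x * (u x * v x) + g x * v x ^ 2)).
Proof.
  intros H x. destruct (H x) as [Hu Hv].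
  split; auto_derive.
  - eexists; exact Hu.
  - rewrite (is_derive_unique (fun t : R => u t) _ _ Hu). ring.
  - eexists; exact Hv.
  - rewrite (is_derive_unique (fun t : R => v t) _ _ Hv). ring.
Qed.

Lemma planar_solution_lincomb (A B g u v c d : R -> R) (s : R) :
  planar_solution A B g u v -> planar_solution A B g c d ->
  planar_solution A B g (fun x => u x - s * c x) (fun x => v x - s * d x).
Proof.
  intros H1 H2 x. destruct (H1 x) as [Hu Hv]. destruct (H2 x) as [Hc Hd].
  split; auto_derive.
  - split; [eexists; exact Hu | split; [eexists; exact Hc | exact I]].
  - rewrite (is_derive_unique (fun t : R => u t) _ _ Hu), (is_derive_unique (fun t : R => c t) _ _ Hc). ring.
  - split; [eexists; exact Hv | split; [eexists; exact Hd | exact I]].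
  - rewrite (is_derive_unique (fun t : R => v t) _ _ Hv), (is_derive_unique (fun t : R => d t) _ _ Hd). ring.
Qed.

(** Gronwall for [u ^ 2 + v ^ 2], whose derivative is [A * (2 u v) + B * (2 u v) + 2 g * (v ^ 2 - u
    ^ 2)]; both [2 u v] and [v ^ 2 - u ^ 2] are bounded by [u ^ 2 + v ^ 2] in absolute value. *)
Lemma planar_solution_unique (A B g u v : R -> R) :
  (forall x, continuous A x) -> (forall x, continuous B x) ->
  (forall x, continuous g x) ->
  planar_solution A B g u v -> u 0 = 0 -> v 0 = 0 ->
  forall x, u x = 0 /\ v x = 0.
Proof.
  intros cA cB cg H u0 v0 x.
  assert (HN : u x ^ 2 + v x ^ 2 = 0).
  { apply (gronwall_zero (fun x => u x ^ 2 + v x ^ 2)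
      (fun x => 2 * (A x * (u x * v x) - g x * u x ^ 2) +
                2 * (B x * (u x * v x) + g x * v x ^ 2))
      (fun x => (Rabs (A x) + Rabs (B x)) + (Rabs (g x) + Rabs (g x)))).
    - intros y.
      assert (ca : forall h : R -> R, continuous h y ->
                   continuous (fun t => Rabs (h t)) y).
      { intros h Hh. apply (continuous_comp h Rabs); [exact Hh | apply continuous_Rabs]. }
      apply (continuous_plus (fun t => Rabs (A t) + Rabs (B t))
                             (fun t => Rabs (g t) + Rabs (g t))).
      + apply (continuous_plus (fun t => Rabs (A t)) (fun t => Rabs (B t))); auto.
      + apply (continuous_plus (fun t => Rabs (g t)) (fun t => Rabs (g t))); auto.
    - intros y. nra.
    - intros y. destruct (planar_solution_bilinear _ _ _ _ _ H y) as [Hu Hv].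
      apply (is_derive_plus (fun t => u t ^ 2) (fun t => v t ^ 2)); assumption.
    - intros y.
      assert (Huv : Rabs (2 * (u y * v y)) <= u y ^ 2 + v y ^ 2).
      { apply Rabs_le. pose proof (pow2_ge_0 (u y - v y)).
        pose proof (pow2_ge_0 (u y + v y)). lra. }
      assert (Hd : Rabs (v y ^ 2 - u y ^ 2) <= u y ^ 2 + v y ^ 2).
      { apply Rabs_le. pose proof (pow2_ge_0 (u y)).
        pose proof (pow2_ge_0 (v y)). lra. }
      assert (Hmul : forall h z, Rabs z <= u y ^ 2 + v y ^ 2 ->
                Rabs (h * z) <= Rabs h * (u y ^ 2 + v y ^ 2)).
      { intros h z Hz. rewrite Rabs_mult.
        apply Rmult_le_compat_l; [apply Rabs_pos | exact Hz]. }
      pose proof (Hmul (A y) _ Huv) as K1. pose proof (Hmul (B y) _ Huv) as K2.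
      pose proof (Hmul (g y) _ Hd) as K3.
      apply Rabs_le_between in K1. apply Rabs_le_between in K2.
      apply Rabs_le_between in K3.
      apply Rabs_le. lra.
    - rewrite u0, v0. ring. }
  split; nra.
Qed.

(** The squares give one sign for each coordinate, and the product ties them together: opposite
    signs force [c * d = 0], and the sign of a vanishing coordinate is free. *)
Lemma eq_up_to_sign (a b c d : R) :
  a ^ 2 = c ^ 2 -> b ^ 2 = d ^ 2 -> a * b = c * d ->
  exists s, (s = 1 \/ s = -1) /\ a - s * c = 0 /\ b - s * d = 0.
Proof.
  intros Ha Hb Hab.
  assert (Ha' : (a - c) * (a + c) = 0) by lra.
  assert (Hb' : (b - d) * (b + d) = 0) by lra.
  destruct (Rmult_integral _ _ Ha') as [Ea | Ea];
    destruct (Rmult_integral _ _ Hb') as [Eb | Eb].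
  - exists 1. split; [left; reflexivity | lra].
  - assert (Hcd : c * d = 0).
    { replace a with c in Hab by lra. replace b with (- d) in Hab by lra. lra. }
    destruct (Rmult_integral _ _ Hcd).
    + exists (-1). split; [right; reflexivity | lra].
    + exists 1. split; [left; reflexivity | lra].
  - assert (Hcd : c * d = 0).
    { replace a with (- c) in Hab by lra. replace b with d in Hab by lra. lra. }
    destruct (Rmult_integral _ _ Hcd).
    + exists 1. split; [left; reflexivity | lra].
    + exists (-1). split; [right; reflexivity | lra].
  - exists (-1). split; [right; reflexivity | lra].
Qed.

Lemma is_lim_diff_sqr (u c : R -> R) :
  is_lim u p_infty 0 -> is_lim c p_infty 0 ->
  is_lim (fun x => u x ^ 2 - c x ^ 2) p_infty 0.
Proof.
  intros Hu Hc.
  apply (is_lim_ext (fun x => u x * u x - c x * c x)); [intros; ring |].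
  replace (Finite 0) with (Finite (0 * 0 - 0 * 0)) by (f_equal; ring).
  apply (is_lim_minus' (fun x => u x * u x) (fun x => c x * c x)).
  - apply (is_lim_mult u u p_infty 0 0 Hu Hu I).
  - apply (is_lim_mult c c p_infty 0 0 Hc Hc I).
Qed.

Lemma planar_solutions_eq_up_to_sign (A B g u v c d : R -> R) :
  (forall x, continuous A x) -> (forall x, continuous B x) ->
  (forall x, continuous g x) ->
  even_fun A -> even_fun B -> even_fun g -> (forall x, B x <> 0) ->
  planar_solution A B g u v -> planar_solution A B g c d ->
  is_lim u p_infty 0 -> is_lim v p_infty 0 ->
  is_lim c p_infty 0 -> is_lim d p_infty 0 ->
  even_fun (fun x => u x ^ 2 - c x ^ 2) ->
  even_fun (fun x => v x ^ 2 - d x ^ 2) ->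
  even_fun (fun x => u x * v x - c x * d x) ->
  exists s, (s = 1 \/ s = -1) /\ forall x, u x = s * c x /\ v x = s * d x.
Proof.
  intros cA cB cg eA eB eg Bne H1 H2 lu lv lc ld Euu Evv Euv.
  assert (Du : forall x, is_derive (fun t => u t ^ 2 - c t ^ 2) x
            (2 * (A x * (u x * v x - c x * d x) - g x * (u x ^ 2 - c x ^ 2)))).
  { intros x.
    destruct (planar_solution_bilinear _ _ _ _ _ H1 x) as [a1 _].
    destruct (planar_solution_bilinear _ _ _ _ _ H2 x) as [a2 _].
    evar_last; [apply (is_derive_minus (fun t => u t ^ 2) _ _ _ _ a1 a2) |].
    unfold minus, plus, opp; simpl; ring. }
  assert (Dv : forall x, is_derive (fun t => v t ^ 2 - d t ^ 2) x
            (2 * (B x * (u x * v x - c x * d x) + g x * (v x ^ 2 - d x ^ 2)))).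
  { intros x.
    destruct (planar_solution_bilinear _ _ _ _ _ H1 x) as [_ a1].
    destruct (planar_solution_bilinear _ _ _ _ _ H2 x) as [_ a2].
    evar_last; [apply (is_derive_minus (fun t => v t ^ 2) _ _ _ _ a1 a2) |].
    unfold minus, plus, opp; simpl; ring. }
  assert (Zu := even_deriv_zero _ _ Du Euu
    ltac:(intros x; rewrite eA, eg, (Euu x), (Euv x); reflexivity)).
  assert (Zv := even_deriv_zero _ _ Dv Evv
    ltac:(intros x; rewrite eB, eg, (Evv x), (Euv x); reflexivity)).
  assert (Vu : forall x, u x ^ 2 - c x ^ 2 = 0).
  { apply (constant_lim_zero (fun x => u x ^ 2 - c x ^ 2)).
    - apply (deriv_zero_constant (fun x => u x ^ 2 - c x ^ 2)).
      intros x. rewrite <- (Zu x). apply Du.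
    - apply is_lim_diff_sqr; assumption. }
  assert (Vv : forall x, v x ^ 2 - d x ^ 2 = 0).
  { apply (constant_lim_zero (fun x => v x ^ 2 - d x ^ 2)).
    - apply (deriv_zero_constant (fun x => v x ^ 2 - d x ^ 2)).
      intros x. rewrite <- (Zv x). apply Dv.
    - apply is_lim_diff_sqr; assumption. }
  (* At 0 the [g] term of [Zv] drops out by [Vv], leaving [2 * B 0] times this difference equal to
     zero. *)
  assert (V0 : u 0 * v 0 - c 0 * d 0 = 0).
  { pose proof (Zv 0) as Z. cbv beta in Z. rewrite (Vv 0) in Z.
    destruct (Rmult_integral (B 0) (u 0 * v 0 - c 0 * d 0)) as [E | E]; [lra | | exact E].
    destruct (Bne 0 E). }
  destruct (eq_up_to_sign (u 0) (v 0) (c 0) (d 0)) as [s [Hs [E1 E2]]].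
  { pose proof (Vu 0); lra. }
  { pose proof (Vv 0); lra. }
  { lra. }
  exists s. split; [exact Hs |]. intros x.
  (* The pair [u - s * c], [v - s * d] solves the same system with zero data at 0. *)
  destruct (planar_solution_unique A B g _ _ cA cB cg
    (planar_solution_lincomb A B g u v c d s H1 H2) E1 E2 x). lra.
Qed.

(** * Reflection, exponential decay and continuity of the coefficients *)

Lemma is_derive_reflect (F : R -> R) (l x : R) :
  is_derive F (- x) l -> is_derive (fun t => F (- t)) x (- l).
Proof.
  intros H. evar_last.
  - apply (is_derive_comp F Ropp x l (-1)); [exact H |].
    auto_derive; [exact I | ring].
  - unfold scal; simpl; unfold mult; simpl; ring.
Qed.

Lemma exp_bound_lim (g : R -> R) (a C : R) : 0 < a ->
  Rbar_locally p_infty (fun x => Rabs (g x) <= C * exp (- (a * x))) ->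
  is_lim g p_infty 0.
Proof.
  intros Ha Hg.
  assert (He : is_lim (fun x => exp (- (a * x))) p_infty 0).
  { apply (is_lim_comp exp (fun x => - (a * x)) p_infty 0 m_infty).
    - apply is_lim_exp_m.
    - apply (is_lim_ext (fun x => (- a) * x)); [intros; ring |].
      evar_last; [apply (is_lim_scal_l (fun x => x) (- a) p_infty); apply is_lim_id |].
      (* The product of [- a] with [p_infty] is computed by a case split on the sign of [- a]; only
         the negative case is consistent. *)
      simpl. destruct (Rle_dec 0 (- a)) as [h | h]; [exfalso; lra | reflexivity].
    - exists 0. intros; discriminate. }
  assert (Hs : forall k, is_lim (fun x => k * exp (- (a * x))) p_infty 0).
  { intros k. replace (Finite 0) with (Rbar_mult k 0) by (simpl; f_equal; ring).
    apply is_lim_scal_l. exact He. }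
  apply (is_lim_le_le_loc (fun x => - C * exp (- (a * x)))
                          (fun x => C * exp (- (a * x)))).
  - revert Hg. apply filter_imp. intros x Hx.
    apply Rabs_le_between in Hx. lra.
  - apply Hs.
  - apply Hs.
Qed.

(** Decay at minus infinity becomes a limit at plus infinity of the reflected function, so that both
    pairs are compared at the same end. *)
Lemma exp_decay_lim (g : R -> R) : exp_decay g ->
  is_lim g p_infty 0 /\ is_lim (fun x => g (- x)) p_infty 0.
Proof.
  intros [[a [C [Ha H]]] [a' [C' [Ha' H']]]]. split.
  - apply (exp_bound_lim g a C); assumption.
  - apply (exp_bound_lim (fun x => g (- x)) a' C'); [assumption |].
    destruct H' as [M HM]. exists (- M). intros x Hx.
    replace (- (a' * x)) with (a' * - x) by ring. apply HM. lra.
Qed.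

Lemma smooth_continuous (g : R -> R) : smooth g -> forall x, continuous g x.
Proof.
  intros H x. apply (ex_derive_continuous g x). apply (H 1%nat x).
Qed.

Lemma continuous_mult_inv (h q : R -> R) (x : R) :
  continuous h x -> continuous q x -> q x <> 0 -> continuous (fun t => h t / q t) x.
Proof.
  intros Hh Hq Hne. apply (continuous_mult h (fun t => / q t)); [exact Hh |].
  apply (continuous_comp q Rinv); [exact Hq |].
  apply (ex_derive_continuous Rinv). auto_derive. exact Hne.
Qed.

Lemma kappa_sign (n : nat) : kappa n = 1 \/ kappa n = -1.
Proof.
  unfold kappa. induction n as [| n IH]; simpl; [left | destruct IH as [-> | ->]]; lra.
Qed.

Theorem mainTheorem3
  (f r : R -> R) (f0 : R) (hbg : symmetric_wormhole f r f0)
  (mu omega : R) (n : nat)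
  (hmu : 0 < mu) (homega : 0 < omega < mu * f0)
  (psi : spinor) (hpsi : bound_state f r mu omega n psi)
  (hS : even_fun (bilinear_S psi))
  (hD : even_fun (bilinear_D psi))
  (hP : even_fun (bilinear_P n psi)) :
  (eigenstate (Zstar n) 1 psi \/ eigenstate (Zstar n) (-1) psi) /\
  (exists s : R, (s = 1 \/ s = -1) /\
     forall x : R, psi0 psi x = s * psi3 psi (- x) /\
                   psi1 psi x = - s * psi2 psi (- x)).
Proof.
  destruct hbg as [sf sr fpos rpos ef er _ _ _].
  destruct hpsi as [[d0 d1 d2 d3 e0 e1 e2 e3] hnt dec0 dec1 dec2 dec3].
  assert (cf := smooth_continuous f sf). assert (cr := smooth_continuous r sr).
  assert (fne : forall x, f x <> 0) by (intros x; specialize (fpos x); lra).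
  assert (rne : forall x, r x <> 0) by (intros x; specialize (rpos x); lra).
  set (la := ell n + 1 / 2) in *.
  assert (hla : 0 < la) by (unfold la, ell; pose proof (pos_INR n); lra).
  assert (hk := kappa_sign n).
  set (A := fun x => (la / r x - omega / f x) / f x).
  set (B := fun x => (la / r x + omega / f x) / f x).
  set (g := fun x => kappa n * mu / f x).
  assert (H : exists s, (s = 1 \/ s = -1) /\ forall x,
     psi0 psi x = s * psi3 psi (- x) /\ psi1 psi x = s * - psi2 psi (- x)).
  { apply (planar_solutions_eq_up_to_sign A B g (psi0 psi) (psi1 psi)
      (fun x => psi3 psi (- x)) (fun x => - psi2 psi (- x))).
    1-3: intros x; apply continuous_mult_inv; auto; try apply continuous_const.
    (* What is left are the numerators of [A] and [B]; splitting the first into two goals makes the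
       second the third goal. *)
    1: apply (continuous_minus (fun t => la / r t) (fun t => omega / f t)).
    3: apply (continuous_plus (fun t => la / r t) (fun t => omega / f t)).
    1-4: apply continuous_mult_inv; auto; apply continuous_const.
    - intros x. unfold A. rewrite ef, er. reflexivity.
    - intros x. unfold B. rewrite ef, er. reflexivity.
    - intros x. unfold g. rewrite ef. reflexivity.
    - intros x. unfold B.
      assert (0 < (la / r x + omega / f x) / f x); [| lra].
      apply Rdiv_lt_0_compat; [| apply fpos].
      apply Rplus_lt_0_compat; apply Rdiv_lt_0_compat; auto; lra.
    - intros x. split.
      + evar_last; [apply Derive_correct, d0 |]. unfold A, g.
        (* Multiplication by [f x] reduces the claim to [e0] solved for [f x] times the derivative.
           The other three components are treated alike, the reflected ones with the equation taken
           at [- x]. *)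
        apply (Rmult_eq_reg_l (f x)); [| apply fne].
        transitivity ((la / r x - omega / f x) * psi1 psi x - kappa n * mu * psi0 psi x).
        * specialize (e0 x). lra.
        * field. auto.
      + evar_last; [apply Derive_correct, d1 |]. unfold B, g.
        apply (Rmult_eq_reg_l (f x)); [| apply fne].
        transitivity ((la / r x + omega / f x) * psi0 psi x + kappa n * mu * psi1 psi x).
        * specialize (e1 x). lra.
        * field. auto.
    - intros x. split.
      + evar_last; [apply is_derive_reflect, Derive_correct, d3 |]. unfold A, g.
        apply (Rmult_eq_reg_l (f x)); [| apply fne].
        transitivity ((la / r x - omega / f x) * - psi2 psi (- x)
                      - kappa n * mu * psi3 psi (- x)).
        * specialize (e3 (- x)). rewrite ef, er in e3. lra.
        * field. auto.
      + evar_last;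
          [apply (is_derive_opp (fun t => psi2 psi (- t))),
             is_derive_reflect, Derive_correct, d2 |].
        unfold B, g, opp; simpl.
        apply (Rmult_eq_reg_l (f x)); [| apply fne].
        transitivity ((la / r x + omega / f x) * psi3 psi (- x)
                      - kappa n * mu * psi2 psi (- x)).
        * specialize (e2 (- x)). rewrite ef, er in e2. lra.
        * field. auto.
    - apply exp_decay_lim, dec0.
    - apply exp_decay_lim, dec1.
    - apply (exp_decay_lim _ dec3).
    - replace (Finite 0) with (Rbar_opp 0) by (simpl; f_equal; ring).
      apply is_lim_opp, (exp_decay_lim _ dec2).
    - intros x. specialize (hS x). specialize (hD x).
      unfold bilinear_S, bilinear_D in *. rewrite Ropp_involutive. lra.
    - intros x. specialize (hS x). specialize (hD x).
      unfold bilinear_S, bilinear_D in *. rewrite Ropp_involutive. lra.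
    - intros x. specialize (hP x).
      unfold bilinear_P in hP. rewrite Ropp_involutive.
      destruct hk as [hk | hk]; rewrite hk in hP; lra. }
  destruct H as [s [Hs H]].
  split.
  - assert (E : eigenstate (Zstar n) (kappa n * s) psi).
    { split; [exact hnt |]. intros x.
      destruct (H x) as [a1 a2]. destruct (H (- x)) as [b1 b2].
      rewrite Ropp_involutive in b1, b2. simpl.
      rewrite a1, a2, b1, b2. destruct Hs; subst s; repeat split; ring. }
    destruct hk as [hk | hk]; destruct Hs; subst s; rewrite hk in E.
    + left. replace 1 with (1 * 1) by ring. exact E.
    + right. replace (-1) with (1 * -1) by ring. exact E.
    + right. replace (-1) with (-1 * 1) by ring. exact E.
    + left. replace 1 with (-1 * -1) by ring. exact E.
  - exists s. split; [exact Hs |]. intros x. destruct (H x). split; lra.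
Qed.
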